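(* Any graph equipped with an adapted complex structure is an expansion of a basic graph. That is, if $\mathcal{G}$ is a graph equipped with an adapted complex structure, then there is a basic graph $\mathcal{B}$ equipped with an adapted complex structure such that $\mathcal{G}$ is an expansion of $\mathcal{B}$.
   Context: Graphs are finite and simple: $\mathcal{G}=(V,E)$ with $V$ a finite set and $E$ a set of 2-element subsets of $V$; $\overline{uv}$ denotes the edge $\{u,v\}$. Label $V=\{v_1,\dots,v_n\}$ and write $e_{i,j}$ ($i<j$) for the edge joining $v_i$ and $v_j$, if it exists. The Lie algebra $\mathfrak{n}_{\mathcal{G}}$ is the real vector space with basis $V\cup E$ and Lie bracket $[v_i,v_j]=e_{i,j}$ for $i<j$ if $v_i,v_j$ are adjacent, $[v_i,v_j]=0$ if they are not adjacent, and all elements of $E$ central. A complex structure on a real Lie algebra $\mathfrak{g}$ is a linear map $J:\mathfrak{g}\to\mathfrak{g}$ with $J^2=-\mathrm{Id}$ and $[x,y]+J([Jx,y]+[x,Jy])-[Jx,Jy]=0$ for all $x,y\in\mathfrak{g}$. An adapted complex structure on the graph $\mathcal{G}$ is a complex structure $J$ on $\mathfrak{n}_{\mathcal{G}}$ such that for every $x\in V\cup E$ either $Jx\in V\cup E$ or $-Jx\in V\cup E$. A graph is basic if it is a disjoint union of copies of the following graphs: $\mathbb{A}_1$ (two vertices, no edges), $\mathbb{A}_2$ (three vertices and exactly one edge), $\mathbb{A}_3$ (four vertices and exactly two edges, which share no vertex). Expansion: let $\mathcal{B}$ be a basic graph with an adapted complex structure $J$. Choose a vertex $u$ and a pair of vertices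 $v,w$ with $w=Jv$, $u\neq v$, $u\neq w$, and add the two edges $\overline{uv}$ and $\overline{uw}$. Repeat this finitely many times (possibly zero), where the same vertices may be used again as long as the two edges added at each step are different from all edges added before. Any graph obtained in this way is called an expansion of $\mathcal{B}$ (it has the same vertices as $\mathcal{B}$). *)

(* Defs.v *)
From HB Require Import structures.
From mathcomp Require Import all_boot all_order all_algebra reals.

Set Implicit Arguments.
Unset Strict Implicit.
Unset Printing Implicit Defensive.

Import GRing.Theory.
Local Open Scope ring_scope.

Record graph (V : finType) := Graph {
  edges : {set {set V}};
  card_edge : forall e, e \in edges -> #|e| = 2%N }.

Definition isomorphic (V W : finType) (G : graph V) (H : graph W) : Prop :=
  exists2 f : V -> W, bijective f & edges H = [set f @: (e : {set V}) | e in edges G].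

Section DisjointUnion.

Variables (I : finType) (W : I -> finType) (H : forall i, graph (W i)).

Definition dunion_edges : {set {set {i : I & W i}}} :=
  \bigcup_(i : I) [set (@Tagged I i W) @: (e : {set W i}) | e in edges (H i)].

Lemma card_dunion_edge e : e \in dunion_edges -> #|e| = 2%N.
Proof.
case/bigcupP => i _ /imsetP [e0 He0 ->].
rewrite card_imset; first exact: card_edge He0.
by move=> a b /eqP; rewrite eq_Tagged => /eqP.
Qed.

Definition disjoint_union : graph {i : I & W i} := Graph card_dunion_edge.

End DisjointUnion.

Lemma A1_subproof (e : {set 'I_2}) : e \in set0 -> #|e| = 2%N.
Proof. by rewrite inE. Qed.

Definition A1 : graph 'I_2 := Graph A1_subproof.

Lemma A2_subproof (e : {set 'I_3}) :
  e \in [set [set (@Ordinal 3 0 isT); (@Ordinal 3 1 isT)]] -> #|e| = 2%N.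
Proof. by rewrite inE => /eqP ->; rewrite cards2. Qed.

Definition A2 : graph 'I_3 := Graph A2_subproof.

Lemma A3_subproof (e : {set 'I_4}) :
  e \in [set [set (@Ordinal 4 0 isT); (@Ordinal 4 1 isT)];
             [set (@Ordinal 4 2 isT); (@Ordinal 4 3 isT)]] -> #|e| = 2%N.
Proof. by rewrite !inE => /orP [] /eqP ->; rewrite cards2. Qed.

Definition A3 : graph 'I_4 := Graph A3_subproof.

(* The index type I may be empty, so the graph without vertices is basic. *)
Definition basic (V : finType) (B : graph V) : Prop :=
  exists (I : finType) (W : I -> finType) (H : forall i, graph (W i)),
    (forall i, isomorphic (H i) A1 \/ isomorphic (H i) A2 \/
               isomorphic (H i) A3) /\
    isomorphic B (disjoint_union H).

Section LieAlgebra.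

Variables (R : realType) (g : lmodType R) (br : g -> g -> g).

Definition is_lie_bracket : Prop :=
  [/\ forall a x y z, br (a *: x + y) z = a *: br x z + br y z,
      forall a x y z, br x (a *: y + z) = a *: br x y + br x z,
      forall x, br x x = 0 &
      forall x y z, br x (br y z) + br y (br z x) + br z (br x y) = 0].

Definition complex_structure (J : {linear g -> g}) : Prop :=
  (forall x, J (J x) = - x) /\
  (forall x y, br x y + J (br (J x) y + br x (J y)) - br (J x) (J y) = 0).

End LieAlgebra.

Definition gbasis (V : finType) (G : graph V) : Type :=
  (V + {e : {set V} | e \in edges G})%type.
HB.instance Definition _ V G := Finite.on (@gbasis V G).

(* The real vector space with basis V u E, as coordinate functions. *)
Definition nG (R : realType) (V : finType) (G : graph V) : Type :=
  {ffun gbasis G -> R^o}.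
HB.instance Definition _ R V G := Vector.on (@nG R V G).

Section GraphLieAlgebra.

Variables (R : realType) (V : finType) (lab : V -> 'I_#|V|) (G : graph V).

Definition basisv (b : gbasis G) : nG R G := [ffun c => (c == b)%:R].

Definition vertv (v : V) : nG R G := basisv (inl v).

(* The edge uv as a basis vector, and 0 if u and v are not adjacent. *)
Definition edgev (u v : V) : nG R G :=
  if insub [set u; v] is Some e then basisv (inr e) else 0.

(* The labelling lab stands for V = {v_1, ..., v_n} and fixes the signs. *)
Definition basis_bracket (b c : gbasis G) : nG R G :=
  match b, c with
  | inl u, inl v =>
      if (lab u < lab v)%N then edgev u v
      else if (lab v < lab u)%N then - edgev u v
      else 0
  | _, _ => 0
  end.

Definition gbracket (x y : nG R G) : nG R G :=
  \sum_b \sum_c (x b * y c) *: basis_bracket b c.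

Lemma basis_bracketC b c : basis_bracket b c = - basis_bracket c b.
Proof.
case: b c => [u|e] [v|f] /=; rewrite ?oppr0 // /edgev setUC.
by case: ltngtP; rewrite ?opprK ?oppr0.
Qed.

Lemma basis_bracketE b c v : basis_bracket b c (inl v) = 0.
Proof.
have E0 u w : edgev u w (inl v) = 0.
  by rewrite /edgev; case: insubP => [e _ _|_]; rewrite ffunE.
case: b c => [u|e] [w|f] /=; rewrite ?ffunE //.
by case: ltngtP => _; rewrite ?ffunE ?E0 ?oppr0.
Qed.

Lemma gbracketE x y v : gbracket x y (inl v) = 0.
Proof.
rewrite /gbracket sum_ffunE big1 // => b _; rewrite sum_ffunE big1 // => c _.
by rewrite ffunE basis_bracketE scaler0.
Qed.

Lemma gbracket_central x y z : gbracket x (gbracket y z) = 0.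
Proof.
rewrite {1}/gbracket big1 // => b _; rewrite big1 // => -[v|e] _.
  by rewrite gbracketE mulr0 scale0r.
by case: b => [?|?] /=; rewrite scaler0.
Qed.

Lemma gbracket_lie : is_lie_bracket gbracket.
Proof.
split.
- move=> a x y z; rewrite /gbracket scaler_sumr -big_split; apply: eq_bigr => b _.
  rewrite scaler_sumr -big_split; apply: eq_bigr => c _ /=.
  by rewrite !ffunE mulrDl scalerDl scalerA -mulrA.
- move=> a x y z; rewrite /gbracket scaler_sumr -big_split; apply: eq_bigr => b _.
  rewrite scaler_sumr -big_split; apply: eq_bigr => c _ /=.
  by rewrite !ffunE mulrDr scalerDl scalerA mulrCA.
- move=> x; set s := gbracket x x.
  have sN : s = - s.
    rewrite {1}/s /gbracket exchange_big -sumrN; apply: eq_bigr => b _ /=.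
    rewrite -sumrN; apply: eq_bigr => c _.
    by rewrite basis_bracketC mulrC scalerN.
  have : s *+ 2 = 0 by rewrite mulr2n {1}sN addNr.
  by move/eqP; rewrite -scaler_nat scaler_eq0 Num.Theory.pnatr_eq0 => /eqP.
- by move=> x y z; rewrite !gbracket_central !addr0.
Qed.

Definition adapted (J : {linear nG R G -> nG R G}) : Prop :=
  complex_structure gbracket J /\
  forall b, exists c, J (basisv b) = basisv c \/ - J (basisv b) = basisv c.

End GraphLieAlgebra.

(* Edge sets reached from B by finitely many steps. The two new edges of a
   step are required not to be present yet, neither in B nor added before. *)
Inductive expansion_edges (R : realType) (V : finType) (B : graph V)
    (J : {linear nG R B -> nG R B}) : {set {set V}} -> Prop :=
| expansion_refl : expansion_edges J (edges B)
| expansion_step E u v w :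
    expansion_edges J E ->
    vertv R B w = J (vertv R B v) -> u != v -> u != w ->
    [set u; v] \notin E -> [set u; w] \notin E ->
    expansion_edges J ([set u; v] |: ([set u; w] |: E)).

Definition is_expansion (R : realType) (V : finType) (B : graph V)
    (J : {linear nG R B -> nG R B}) (G : graph V) : Prop :=
  expansion_edges J (edges G).

(* Main.v *)
(* An adapted complex structure permutes V u E up to signs through an involution
   j without fixed points.  If e = {u, v} is an edge with j u <> v, the
   e-coordinate of the integrability condition for (u, v) forces j e to be
   {u, j v} or {j u, v}; so the edges not of the form {v, j v} come in couples
   {u, v}, {u, j v} exchanged by j, and each couple is one expansion step.  The
   remaining edges {v, j v} form a graph B with V u E(B) stable under j.  An edge
   e of B together with j e spans a copy of A2 or A3, according to whether j e is
   a vertex or an edge; the other vertices are matched by j into copies of A1. *)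
Require Import Defs.
From HB Require Import structures.
From mathcomp Require Import all_boot all_order all_algebra reals ring.

Set Implicit Arguments.
Unset Strict Implicit.
Unset Printing Implicit Defensive.

Import GRing.Theory.
Local Open Scope ring_scope.

(** * Unordered pairs, induced subgraphs and splittings into blocks *)

Lemma isomorphic_sym (V W : finType) (G : graph V) (H : graph W) :
  isomorphic G H -> isomorphic H G.
Proof.
case=> f [g fK gK] EH; exists g; first by exists f.
rewrite EH -imset_comp -[LHS]imset_id; apply: eq_imset => e /=.
by rewrite -imset_comp (eq_imset (g := id)) ?imset_id.
Qed.

Lemma eq_set2 (T : finType) (u v b c : T) : u != v ->
  ([set u; v] == [set b; c]) = (b == u) && (c == v) || (b == v) && (c == u).
Proof.
move=> uv; apply/eqP/orP => [E|]; last first.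
  by case=> /andP [/eqP-> /eqP->] //; rewrite setUC.
have /set2P [ub|uc] : u \in [set b; c] by rewrite -E set21.
  have /set2P [vb|vc] : v \in [set b; c] by rewrite -E set22.
    by rewrite ub vb eqxx in uv.
  by left; rewrite ub vc !eqxx.
have /set2P [vb|vc] : v \in [set b; c] by rewrite -E set22.
  by right; rewrite uc vb !eqxx.
by rewrite uc vc eqxx in uv.
Qed.

Lemma edge_neq (V : finType) (G : graph V) u v :
  [set u; v] \in edges G -> u != v.
Proof. by move/card_edge; rewrite cards2; case: (u == v). Qed.

Section Induced.

Variables (V : finType) (G : graph V) (A : {set V}).

Lemma card_induced_edge (e : {set {x | x \in A}}) :
  e \in [set e0 : {set {x | x \in A}} | val @: e0 \in edges G] -> #|e| = 2%N.
Proof. by rewrite inE => /card_edge; rewrite card_imset //; exact: val_inj. Qed.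

Definition induced : graph {x | x \in A} := Graph card_induced_edge.

Lemma val_edge_induced e : e \in edges G -> e \subset A ->
  exists2 e0, e0 \in edges induced & e = val @: e0.
Proof.
move=> eG /subsetP eA.
have Ee : e = val @: [set z : {x | x \in A} | val z \in e].
  apply/setP=> x; apply/idP/imsetP => [xe|[z + ->]]; last by rewrite inE.
  by exists (Sub x (eA x xe)); rewrite ?inE SubK.
by exists [set z : {x | x \in A} | val z \in e]; rewrite // inE -Ee.
Qed.

(** The tuple [t] enumerates [A] without repetition, so [tnth t] is a bijection onto [A]. Edges are
    compared as subsets of [V], which keeps the subtype out of the checks for [A1], [A2] and
    [A3]. *)
Lemma isomorphic_induced k (K : graph 'I_k) (t : k.-tuple V) :
  uniq t -> A =i t ->
  (forall e, (e \in [set tnth t @: (e0 : {set 'I_k}) | e0 in edges K]) =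
             (e \in edges G) && (e \subset A)) ->
  isomorphic induced K.
Proof.
move=> /tuple_uniqP t_inj At EK; apply: isomorphic_sym.
have tA i : tnth t i \in A by rewrite At mem_tnth.
pose h i : {x | x \in A} := Sub (tnth t i) (tA i).
have h_inj : injective h by move=> i1 i2 /(congr1 val) /t_inj.
have valh (e : {set 'I_k}) : val @: (h @: e) = tnth t @: e.
  by rewrite -imset_comp.
exists h.
  have hinv (x : {x | x \in A}) : exists i, h i == x.
    have := valP x; rewrite At => /tnthP [i Ei]; exists i.
    by apply/eqP/val_inj; rewrite Ei.
  pose h' x := xchoose (hinv x).
  have h'K : cancel h' h by move=> x; apply/eqP/(xchooseP (hinv x)).
  by exists h' => //; apply: inj_can_sym.
apply/setP=> e; apply/idP/imsetP => [|[e0 e0K ->]].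
  rewrite inE => eG; have eA : val @: e \subset A.
    by apply/subsetP=> _ /imsetP [z _ ->]; apply: valP.
  have : val @: e \in [set tnth t @: (e0 : {set 'I_k}) | e0 in edges K].
    by rewrite EK eG eA.
  case/imsetP=> e0 e0K; rewrite -valh => /(imset_inj val_inj) ->.
  by exists e0.
have : tnth t @: e0 \in [set tnth t @: (e0 : {set 'I_k}) | e0 in edges K].
  exact: imset_f.
by rewrite EK inE valh => /andP [].
Qed.

End Induced.

(** The hypotheses make the blocks the classes of a partition that no edge crosses. Forgetting the
    index is injective because a point determines its block. *)
Lemma isomorphic_blocks (V : finType) (G : graph V) (blk : V -> {set V}) :
    (forall v, v \in blk v) ->
    (forall u v, u \in blk v -> blk u = blk v) ->
    (forall u v, [set u; v] \in edges G -> blk u = blk v) ->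
  isomorphic G (disjoint_union
    (fun i : {A : {set V} | A \in [set blk v | v in V]} => induced G (val i))).
Proof.
pose I : finType := {A : {set V} | A \in [set blk v | v in V]}.
pose W (i : I) : finType := {x | x \in val i}.
move=> blkv blkE blkG.
apply: isomorphic_sym; pose g (p : {i : I & W i}) : V := val (tagged p).
have valI (i : I) x : x \in val i -> val i = blk x.
  by case/imsetP: (valP i) => v _ -> /blkE.
have blkI v : blk v \in [set blk v | v in V] by apply: imset_f.
pose h v : {i : I & W i} := existT W (Sub (blk v) (blkI v)) (Sub v (blkv v)).
have hK : cancel h g by [].
have g_inj : injective g.
  move=> [i x] [i' x']; rewrite /g /= => Exx'.
  have Ei : i = i'.
    apply: val_inj; rewrite (valI _ _ (valP x)) (valI _ _ (valP x')).
    exact: congr1 Exx'.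
  by case: i' / Ei x' Exx' => x' /val_inj ->.
exists g; first by exists h => //; apply: inj_can_sym.
apply/setP=> e; apply/idP/imsetP.
  move=> eG; have /eqP/cards2P [u [v [_ Ee]]] := card_edge eG.
  have eblk : e \subset val (Sub (blk u) (blkI u) : I).
    rewrite SubK Ee; apply/subsetP=> x /set2P [] ->; first exact: blkv.
    by rewrite (blkG u v) // -Ee.
  have [e0 e0G E0] := val_edge_induced eG eblk.
  exists ((@Tagged I (Sub (blk u) (blkI u)) W) @: (e0 : {set W _})).
    by apply/bigcupP; exists (Sub (blk u) (blkI u)) => //; apply: imset_f.
  by rewrite -imset_comp.
case=> _ /bigcupP [i _ /imsetP [e0 e0G ->]] ->.
by rewrite -imset_comp; move: e0G; rewrite inE.
Qed.

(** * Graphs all of whose edges are paired by an involution *)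

Section PairedBasic.

Variables (V : finType) (B : graph V) (j : gbasis B -> gbasis B).
Hypotheses (jK : involutive j) (jn : forall b, j b != b).
Hypothesis edge_paired : forall e : {e | e \in edges B},
  exists v w, val e = [set v; w] /\ j (inl v) = inl w.

Let supp (b : gbasis B) : {set V} :=
  match b with inl v => [set v] | inr e => val e end.

Let T b := supp b :|: supp (j b).

(* The component of v: T of the edge {v, j v} or j v, if there is one. *)
Let blk v : {set V} :=
  match j (inl v) with
  | inl w => if insub [set v; w] is Some e then T (inr e) else [set v; w]
  | inr e => T (inr e)
  end.

Lemma paired_mem (e : {e | e \in edges B}) x :
  x \in val e -> exists2 y, j (inl x) = inl y & val e = [set x; y].
Proof.
have [v [w [-> jv]]] := edge_paired e; case/set2P=> ->; first by exists w.
by exists v; rewrite 1?setUC // -jv jK.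
Qed.

(** An edge through [x] can only be [x] with its partner under [j], so the edges form a matching. *)
Lemma paired_edge_inj (e f : {e | e \in edges B}) x :
  x \in val e -> x \in val f -> e = f.
Proof.
move=> /paired_mem [y jx Ee] /paired_mem [z]; rewrite jx => -[<-] Ef.
by apply: val_inj; rewrite Ee Ef.
Qed.

Lemma blk_edge (e : {e | e \in edges B}) x : x \in val e -> blk x = T (inr e).
Proof.
move=> xe; have [y jx Ee] := paired_mem xe.
by rewrite /blk jx -Ee valK.
Qed.

(** A point of [T (inr e)] off [e] comes from [j (inr e)], and applying [j] again leads back to
    [e]. *)
Lemma blk_T (e : {e | e \in edges B}) x : x \in T (inr e) -> blk x = T (inr e).
Proof.
case/setUP=> [|]; first exact: blk_edge.
case je: (j (inr e)) => [v|f] /=.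
  by move/set1P=> ->; rewrite /blk -je jK.
by move/blk_edge->; rewrite /T -je jK setUC.
Qed.

Lemma blkP v :
  (exists2 e : {e | e \in edges B}, blk v = T (inr e) & v \in T (inr e)) \/
  (exists w, [/\ blk v = [set v; w], j (inl v) = inl w &
     [set v; w] \notin edges B]).
Proof.
rewrite /blk; case jv: (j (inl v)) => [w|e].
  case: insubP => [e _ Ee|nE]; last by right; exists w.
  by left; exists e; rewrite // /T inE /= Ee set21.
by left; exists e; rewrite // /T -jv jK !inE eqxx orbT.
Qed.

Lemma mem_blk v : v \in blk v.
Proof. by case: (blkP v) => [[e ->]|[w [-> _ _]]] //; rewrite set21. Qed.

Lemma blk_eq u v : u \in blk v -> blk u = blk v.
Proof.
case: (blkP v) => [[e -> _]|[w [Ev jv nE]]]; first exact: blk_T.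
rewrite Ev => /set2P [] -> //; rewrite /blk -jv jK setUC insubF //.
exact: negbTE.
Qed.

Lemma blk_adj u v : [set u; v] \in edges B -> blk u = blk v.
Proof.
move=> uvB; pose e : {e | e \in edges B} := Sub [set u; v] uvB.
by rewrite (blk_edge (e := e)) ?(blk_edge (x := v) (e := e)) ?set21 ?set22.
Qed.

(** A vertex of [f] is sent by [j] to a vertex, so it cannot be the vertex [j (inr e)], which goes
    to an edge. It lies on [e] or on the edge [j (inr e)], and distinct edges are disjoint. *)
Lemma edge_in_T (e f : {e | e \in edges B}) :
  val f \subset T (inr e) -> f = e \/ inr f = j (inr e).
Proof.
have [v [w [Ef jv]]] := edge_paired f => /subsetP/(_ v).
have vf : v \in val f by rewrite Ef set21.
move/(_ vf)/setUP=> [ve|]; first by left; apply: paired_edge_inj vf ve.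
case je: (j (inr e)) => [x|f'] /=; last first.
  by right; rewrite (paired_edge_inj vf (f := f')).
by move/set1P=> Ev; move: jv; rewrite Ev -je jK.
Qed.

Lemma blk_isomorphic v :
  let H := induced B (blk v) in
  isomorphic H A1 \/ isomorphic H A2 \/ isomorphic H A3.
Proof.
case: (blkP v) => [[e -> _]|[w [-> jv nE]]]; last first.
  left; apply: (isomorphic_induced (t := [tuple v; w])).
  - rewrite /= inE andbT; apply/eqP=> vw.
    by have /eqP := jn (inl v); rewrite jv vw.
  - by move=> x; rewrite !inE.
  move=> e; rewrite imset0 inE; apply/esym/negP=> /andP [eB].
  rewrite subEproper => /predU1P [Ee|/proper_card].
    by rewrite -Ee eB in nE.
  by rewrite (card_edge eB) cards2; case: eqP.
right; have [a [b [Ee ja]]] := edge_paired e.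
have ab : a != b by apply: (@edge_neq _ B); rewrite -Ee; apply: valP.
case je: (j (inr e)) => [u|f]; [left | right].
  have ET : T (inr e) = [set a; b; u] by rewrite /T je /= Ee.
  have ju : j (inl u) = inr e by rewrite -je jK.
  apply: (isomorphic_induced (t := [tuple a; b; u])).
  (* [u] differs from [a] and [b] because [j] sends [u] to an edge but [a] and [b] to vertices. *)
  - rewrite /= !inE negb_or ab /= andbT; apply/andP; split; apply/eqP.
      by move=> Ea; move: ju; rewrite -Ea ja.
    by move=> Eb; move: ju; rewrite -Eb -ja jK.
  - by move=> x; rewrite ET !inE orbA.
  move=> e'; rewrite imset_set1 imsetU !imset_set1 inE.
  rewrite !(tnth_nth a) /= -Ee; apply/eqP/andP => [->|[e'B]].
    by split; [apply: valP | rewrite subsetUl].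
  by case/(@edge_in_T e (Sub e' e'B)) => [<-|]; rewrite // je.
have [c [d [Ef jc]]] := edge_paired f.
have cd : c != d by apply: (@edge_neq _ B); rewrite -Ef; apply: valP.
have ET : T (inr e) = [set a; b] :|: [set c; d] by rewrite /T je /= Ee Ef.
(* A common vertex would give [e = f], hence a fixed point of [j]. *)
have dis x y : x \in [set a; b] -> y \in [set c; d] -> x != y.
  rewrite -Ee -Ef => xe yf; apply/eqP=> xy; rewrite -xy in yf.
  by have /eqP := jn (inr e); rewrite je (paired_edge_inj xe yf).
apply: (isomorphic_induced (t := [tuple a; b; c; d])).
- by rewrite /= !inE !negb_or ab cd !dis ?set21 ?set22.
- by move=> x; rewrite ET !inE !orbA.
move=> e'; rewrite imsetU !imset_set1 !imsetU !imset_set1 inE !inE.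
rewrite !(tnth_nth a) /= -Ee -Ef; apply/orP/andP => [[]/eqP->|[e'B]].
- by split; [apply: valP | rewrite subsetUl].
- by split; [apply: valP | rewrite /T je subsetUr].
case/(@edge_in_T e (Sub e' e'B)) => [<-|]; first by left.
by rewrite je => -[<-]; right.
Qed.

Lemma basic_of_pairing : basic B.
Proof.
pose I : finType := {A : {set V} | A \in [set blk v | v in V]}.
pose W (i : I) : finType := {x | x \in val i}.
exists I, W, (fun i => induced B (val i)); split; last first.
  exact: isomorphic_blocks mem_blk blk_eq blk_adj.
move=> i; case/imsetP: (valP i) => v _ Ei.
by have := blk_isomorphic v; rewrite -Ei.
Qed.

End PairedBasic.

(** * Signed permutations of the basis *)

Section Bracket.

Variables (R : realType) (V : finType) (lab : V -> 'I_#|V|) (G : graph V).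
Hypothesis lab_inj : injective lab.
Implicit Types (x y : nG R G) (e : {e | e \in edges G}).

Lemma edgevE u v e : edgev R G u v (inr e) = (val e == [set u; v])%:R.
Proof.
rewrite /edgev; case: insubP => [e' _ Ee'|nE]; rewrite ffunE.
  by rewrite -Ee' (inj_eq val_inj).
by case: eqP => // Ee; rewrite -Ee (valP e) in nE.
Qed.

(** The coefficient of the edge in the bracket of two adjacent vertices; the value at [u = v] has no
    meaning. *)
Definition bracket_sign u v : R := if (lab u < lab v)%N then 1 else -1.

Lemma bracket_sign_neq0 u v : bracket_sign u v != 0.
Proof. by rewrite /bracket_sign; case: ifP; rewrite ?oppr_eq0 oner_eq0. Qed.

(** Only the ordered pairs [(u, v)] and [(v, u)] of basis vectors reach [e], with opposite signs,
    which leaves a 2 by 2 determinant up to sign. *)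
Lemma gbracket_coord x y u v e : val e = [set u; v] ->
  gbracket lab x y (inr e) =
  bracket_sign u v * (x (inl u) * y (inl v) - x (inl v) * y (inl u)).
Proof.
move=> Ee; have uv : u != v by apply: (@edge_neq _ G); rewrite -Ee; apply: valP.
have luv : lab u != lab v :> nat by rewrite (inj_eq val_inj) (inj_eq lab_inj).
have bE b c : basis_bracket R lab b c (inr e) =
    ((b, c) == (inl u, inl v))%:R * bracket_sign u v
    - ((b, c) == (inl v, inl u))%:R * bracket_sign u v.
  case: b c => [b|b] [c|c] /=;
    rewrite ?ffunE ?xpair_eqE ?andbF ?mul0r ?subr0 //.
  have inlE a a' : (inl a == inl a' :> gbasis G) = (a == a') by [].
  rewrite !inlE /bracket_sign.
  have [/andP [/eqP-> /eqP->]|n1] := boolP ((b == u) && (c == v)).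
    rewrite (negbTE uv) mul0r subr0 mul1r.
    by case: ltngtP luv => // _ _; rewrite ?ffunE edgevE Ee eqxx.
  have [/andP [/eqP-> /eqP->]|n2] := boolP ((b == v) && (c == u)).
    rewrite mul0r sub0r mul1r.
    by case: ltngtP luv => // _ _; rewrite ?ffunE edgevE Ee setUC eqxx ?opprK.
  have Ebc : (val e == [set b; c]) = false.
    by rewrite Ee eq_set2 // (negbTE n1) (negbTE n2).
  rewrite !mul0r subrr.
  by do 2?case: ifP => _; rewrite ?ffunE ?edgevE ?Ebc ?oppr0.
rewrite /gbracket sum_ffunE.
under eq_bigr do rewrite sum_ffunE.
rewrite pair_bigA /= (eq_bigr (fun p : gbasis G * gbasis G =>
   (if p == (inl u, inl v) then x p.1 * y p.2 * bracket_sign u v else 0)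
   - (if p == (inl v, inl u) then x p.1 * y p.2 * bracket_sign u v else 0))).
  by rewrite sumrB -!big_mkcond !big_pred1_eq /= -mulrBl mulrC.
move=> [b c] _; rewrite ffunE bE /=.
do 2!case: eqP => _; rewrite ?mul0r ?mul1r ?subrr ?subr0 ?sub0r ?scaler0 //.
exact: scalerN.
Qed.

End Bracket.

(** * Signed involutions of the basis and integrability *)

Section SignedInvolution.

Variables (R : realType) (V : finType) (lab : V -> 'I_#|V|) (G : graph V).
Variables (s : gbasis G -> bool) (j : gbasis G -> gbasis G).

(** For involutive [j], the linear map taking [b] to [j b] with sign [(-1) ^+ s b]: the coordinate
    at [b] is carried there from [j b]. *)
Definition signed_map (x : nG R G) : nG R G :=
  [ffun b => (-1) ^+ s (j b) * x (j b)].

Lemma signed_map_linear : linear signed_map.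
Proof.
move=> a x y; apply/ffunP=> b; rewrite !ffunE mulrDr.
by congr (_ + _); rewrite mulrCA.
Qed.

HB.instance Definition _ :=
  GRing.isLinear.Build R (nG R G) (nG R G) _ signed_map signed_map_linear.

Hypotheses (lab_inj : injective lab) (jK : involutive j).
Hypothesis sj : forall b, s (j b) = ~~ s b.

Lemma signed_map_basisv b :
  signed_map (basisv R b) = (-1) ^+ s b *: basisv R (j b).
Proof.
apply/ffunP=> c; rewrite !ffunE (canF_eq jK) -[LHS]/(_ * _) -[RHS]/(_ * _).
by case: eqP => [->|]; rewrite ?jK ?mulr0.
Qed.

Lemma signed_mapK x : signed_map (signed_map x) = - x.
Proof.
apply/ffunP=> c; rewrite !ffunE jK sj mulrA -signr_addb addNb addbb.
by rewrite mulN1r.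
Qed.

(** On the coordinates of an edge [{v, j v}] the map is a quarter turn, of trace 0 and determinant
    1. As the bracket is a determinant there, [[Jx, y] + [x, Jy] = 0] and [[Jx, Jy] = [x, y]]. *)
Lemma adapted_signed_map :
    (forall e : {e | e \in edges G},
       exists v w, val e = [set v; w] /\ j (inl v) = inl w) ->
  adapted lab (signed_map : {linear nG R G -> nG R G}).
Proof.
move=> paired; split; last first.
  move=> b; exists (j b); rewrite /= signed_map_basisv.
  case: (s b); last by left; rewrite scale1r.
  by right; rewrite expr1 scaleN1r opprK.
split=> [|x y] /=; first exact: signed_mapK.
have sumE e : gbracket lab (signed_map x) y (inr e)
            + gbracket lab x (signed_map y) (inr e) = 0.
  have [v [w [Ee jv]]] := paired e.
  have jw : j (inl w) = inl v by rewrite -jv jK.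
  rewrite !(gbracket_coord lab_inj _ _ Ee) !ffunE jv jw -jv sj.
  by case: (s _) => /=; rewrite expr0 expr1; ring.
have difE e : gbracket lab (signed_map x) (signed_map y) (inr e)
            = gbracket lab x y (inr e).
  have [v [w [Ee jv]]] := paired e.
  have jw : j (inl w) = inl v by rewrite -jv jK.
  rewrite !(gbracket_coord lab_inj _ _ Ee) !ffunE jv jw -jv sj.
  by case: (s _) => /=; rewrite expr0 expr1; ring.
have -> : gbracket lab (signed_map x) y + gbracket lab x (signed_map y) = 0.
  apply/ffunP=> -[v|e]; rewrite !ffunE ?gbracketE ?addr0 //.
have -> : gbracket lab (signed_map x) (signed_map y) = gbracket lab x y.
  by apply/ffunP=> -[v|e]; rewrite ?gbracketE.
by rewrite linear0 addr0 subrr.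
Qed.

(** At [e] the bracket of [u] and [v] is nonzero and that of their images vanishes, so the term
    under [J] must compensate. The vertices [u'], [v'] are [u], [v] in one of the two orders, which
    merges the two possible forms of [j (inr e)]. *)
Lemma nonpair_edge (e : {e | e \in edges G}) u v :
    complex_structure (@gbracket R V lab G)
      (signed_map : {linear nG R G -> nG R G}) ->
    val e = [set u; v] -> j (inl u) != inl v ->
  exists u' v' w f, [/\ val e = [set u'; v'], j (inr e) = inr f,
    val f = [set u'; w] & j (inl v') = inl w].
Proof.
case=> _ /(_ (vertv R G u) (vertv R G v)) /ffunP /(_ (inr e)) /= + Ee juv.
have uv : u != v by apply: (@edge_neq _ G); rewrite -Ee; apply: valP.
have jb b : (j b == b) = false.
  by apply/eqP=> E; have := sj b; rewrite E; case: (s b).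
have jvu : (j (inl v) == inl u) = false.
  by rewrite (canF_eq jK) eq_sym; apply: negbTE.
have Euv : gbracket lab (vertv R G u) (vertv R G v) (inr e) =
    bracket_sign R lab u v.
  rewrite (gbracket_coord lab_inj _ _ Ee) !ffunE !eqxx.
  have -> : (inl v == inl u :> gbasis G) = false.
    by rewrite eq_sym; apply: negbTE.
  by rewrite mul0r subr0 !mulr1.
have EJ : gbracket lab (signed_map (vertv R G u))
    (signed_map (vertv R G v)) (inr e) = 0.
  rewrite (gbracket_coord lab_inj _ _ Ee) !ffunE !jb jvu.
  by rewrite !mulr0 !mul0r subr0 mulr0.
(* The map reads its coordinate at [e] from [j (inr e)], so [S] is the term under [J] up to sign. *)
pose S : R := gbracket lab (signed_map (vertv R G u)) (vertv R G v) (j (inr e))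
  + gbracket lab (vertv R G u) (signed_map (vertv R G v)) (j (inr e)).
rewrite !ffunE Euv EJ oppr0 addr0 -/S => N.
have S0 : S != 0.
  apply/eqP=> S0; move/eqP: N; rewrite S0 mulr0 addr0; apply/negP.
  exact: bracket_sign_neq0.
move: S0; rewrite {N}/S.
(* Brackets have no vertex coordinates, so [j (inr e)] must be an edge. *)
case je: (j (inr e)) => [a|f]; first by rewrite !gbracketE addr0 eqxx.
have /eqP/cards2P [a [b [ab Ef]]] := card_edge (valP f).
rewrite !(gbracket_coord lab_inj _ _ Ef) !ffunE !(canF_eq jK).
(* A product in [S] is nonzero only if [f] joins [j u] to [v] or [u] to [j v], with its ends [a],
   [b] in either order; outside these four cases [S] vanishes. *)
have [/andP [/eqP Eu /eqP [Ev]] _|n1] :=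
    boolP ((inl a == j (inl u)) && (inl b == inl v :> gbasis G)).
  by exists v, u, a, f; rewrite Ee Ef -Eu -Ev; split=> //; rewrite setUC.
have [/andP [/eqP Eu /eqP [Ev]] _|n2] :=
    boolP ((inl b == j (inl u)) && (inl a == inl v :> gbasis G)).
  by exists v, u, b, f; rewrite Ee Ef -Eu -Ev; split=> //; rewrite setUC.
have [/andP [/eqP [Eu] /eqP Ev] _|n3] :=
    boolP ((inl a == inl u :> gbasis G) && (inl b == j (inl v))).
  by exists u, v, b, f; rewrite Ee Ef -Eu -Ev.
have [/andP [/eqP [Eu] /eqP Ev] _|n4] :=
    boolP ((inl b == inl u :> gbasis G) && (inl a == j (inl v))).
  by exists u, v, a, f; rewrite Ee Ef -Eu -Ev; split=> //; rewrite setUC.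
move: n1 n2 n3 n4; rewrite !negb_and.
do 4!case/orP => /negbTE ->.
all: by rewrite !(mulr0, mul0r, subr0, addr0) eqxx.
Qed.

End SignedInvolution.

(** * Adapted complex structures as signed involutions *)

Section SignedPermutation.

Variables (R : realType) (V : finType) (lab : V -> 'I_#|V|) (G : graph V).
Variable J : {linear nG R G -> nG R G}.

(** A sign and an image are chosen for each basis vector. By independence, [J (J b) = - b] yields at
    once that [j] is an involution and that the signs at [b] and [j b] differ. *)
Lemma adapted_signed : adapted lab J -> exists s j,
  [/\ involutive j, forall b, s (j b) = ~~ s b & J =1 signed_map s j].
Proof.
case=> -[JJ _] JP.
have basisv_inj (t : bool) (b c : gbasis G) :
    (-1) ^+ t *: basisv R b = basisv R c -> t = false /\ b = c.
  move=> /ffunP /(_ b); rewrite !ffunE eqxx.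
  rewrite -[_ *: _]/(_ * _) mulr1; case: (eqVneq b c) => [-> E|_ /eqP].
    by split=> //; apply: (@Num.Theory.signr_inj R).
  by rewrite signr_eq0.
have /fin_all_exists [p Jp] : forall b, exists p : bool * gbasis G,
    J (basisv R b) = (-1) ^+ p.1 *: basisv R p.2.
  move=> b; have [c [Jb|Jb]] := JP b.
    by exists (false, c); rewrite scale1r.
  by exists (true, c); rewrite expr1 scaleN1r -Jb opprK.
pose s b := (p b).1; pose j b := (p b).2.
have sjj b : ~~ (s b (+) s (j b)) = false /\ j (j b) = b.
  apply: basisv_inj.
  rewrite signrN scaleNr signr_addb -scalerA -Jp -/(s b).
  by rewrite /s /j -linearZ_LR -Jp JJ opprK.
have jK : involutive j by move=> b; case: (sjj b).
exists s, j; split=> // [b|x].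
  by case: (sjj b); case: (s b); case: (s (j b)).
have Ex : x = \sum_b x b *: basisv R b.
  apply/ffunP=> c; rewrite sum_ffunE (bigD1 c) //= !ffunE eqxx big1 ?addr0.
    by rewrite -[_ *: _]/(_ * _) mulr1.
  move=> b /negbTE bc; rewrite !ffunE eq_sym bc; exact: scaler0.
rewrite [in LHS]Ex [in RHS]Ex !linear_sum; apply: eq_bigr => b _.
by rewrite !linearZ /= signed_map_basisv // Jp.
Qed.

End SignedPermutation.

(** * Removing the edges exchanged by the complex structure *)

(** Induction on [#|F|]: a couple [e], [sw e] is split off and added back as the last step. The
    disjunction leaves open which of [v], [w] is the image of the other, since this depends on a
    sign. *)
Lemma expansion_of_swaps (R : realType) (V : finType) (B : graph V)
    (JB : {linear nG R B -> nG R B}) (sw : {set V} -> {set V})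
    (F : {set {set V}}) :
    [disjoint F & edges B] ->
    (forall e, e \in F -> [/\ sw e \in F, sw (sw e) = e, sw e != e &
      exists u v w, [/\ e = [set u; v], sw e = [set u; w], u != v, u != w &
        vertv R B w = JB (vertv R B v) \/ vertv R B v = JB (vertv R B w)]]) ->
  expansion_edges JB (F :|: edges B).
Proof.
have [n] := ubnP #|F|; elim: n F => // n IHn F /ltnSE leFn dis FP.
have [->|[e eF]] := set_0Vmem F; first by rewrite set0U; apply: expansion_refl.
have [sF swK ne [u [v [w [Ee Es uv uw Jvw]]]]] := FP e eF.
pose F' := F :\ e :\ sw e.
have F'F x : x \in F' -> x \in F by rewrite !inE => /and3P [].
have FE : F :|: edges B = e |: (sw e |: (F' :|: edges B)).
  apply/setP=> x; rewrite !inE.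
  case: (eqVneq x e) => [->|_]; first by rewrite eF.
  by case: (eqVneq x (sw e)) => [->|_]; rewrite ?sF.
have E' : expansion_edges JB (F' :|: edges B).
  apply: IHn.
  - apply: leq_trans leFn; rewrite (cardsD1 e F) eF.
    by rewrite (cardsD1 (sw e) (F :\ e)) !inE ne sF ltnS leqnSn.
  - by apply: disjointWl dis; apply/subsetP.
  (* As [sw] is an involution on [F], removing [e] together with [sw e] leaves a set closed under
     [sw]. *)
  move=> x xF'; have [sxF sxK nx xP] := FP x (F'F x xF'); split=> //.
  move: xF'; rewrite !inE sxF andbT => /and3P [xs xe _].
  apply/andP; split; [apply: contraNneq xe | apply: contraNneq xs] => E.
    by rewrite -sxK E swK.
  by rewrite -sxK E.
have nB x : x \in F -> x \notin edges B by move=> xF; rewrite (disjointFr dis).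
have eN : e \notin F' :|: edges B by rewrite !inE eqxx andbF nB.
have sN : sw e \notin F' :|: edges B by rewrite !inE eqxx nB.
rewrite FE; case: Jvw => J_vw.
  by move: eN sN; rewrite Es Ee => eN sN; apply: expansion_step J_vw _ _ _ _.
(* Here [v] is the image of [w], so the two exchange roles and their edges are added in the other
   order. *)
rewrite setUCA; move: eN sN; rewrite Es Ee => eN sN.
exact: expansion_step J_vw _ _ _ _.
Qed.

(** * The subgraph of the edges [{v, j v}] and the inclusion of its basis *)

Section PairGraph.

Variables (V : finType) (G : graph V) (j : gbasis G -> gbasis G).

Definition pair_edges : {set {set V}} :=
  [set e in edges G |
    [exists v, [exists w, (j (inl v) == inl w) && (e == [set v; w])]]].

Lemma card_pair_edge e : e \in pair_edges -> #|e| = 2%N.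
Proof. by rewrite inE => /andP [/card_edge]. Qed.

Definition pair_graph : graph V := Graph card_pair_edge.

Lemma pair_edge_sub e : e \in pair_edges -> e \in edges G.
Proof. by rewrite inE => /andP []. Qed.

Lemma pair_edgeP e : e \in edges G ->
  reflect (exists v w, j (inl v) = inl w /\ e = [set v; w]) (e \in pair_edges).
Proof.
move=> eG; rewrite inE eG; apply: (iffP existsP).
  move=> [v /existsP [w]].
  by case/andP=> /eqP jv /eqP ->; exists v, w.
move=> [v [w [jv ->]]].
by exists v; apply/existsP; exists w; rewrite jv !eqxx.
Qed.

Definition pair_basis (b : gbasis pair_graph) : gbasis G :=
  match b with
  | inl v => inl v
  | inr e => inr (Sub (val e) (pair_edge_sub (valP e)))
  end.

Lemma pair_basis_inj : injective pair_basis.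
Proof.
move=> [v|e] [w|f] //= [] // => [->//|] Eef.
by congr inr; apply: val_inj.
Qed.

Lemma pair_basis_onto (b : gbasis G) :
  (if b is inr e then val e \in pair_edges else true) ->
  exists c, pair_basis c = b.
Proof.
case: b => [v|e] ePE; first by exists (inl v).
by exists (inr (Sub (val e) ePE)); congr inr; apply: val_inj.
Qed.

End PairGraph.

Theorem theorem5p15 (R : realType) (V : finType) (lab : V -> 'I_#|V|)
    (hlab : bijective lab) (G : graph V) (J : {linear nG R G -> nG R G}) :
  adapted lab J ->
  exists (B : graph V) (JB : {linear nG R B -> nG R B}),
    [/\ basic B, adapted lab JB & is_expansion JB G].
Proof.
have lab_inj := bij_inj hlab => aJ.
have [s [j [jK sj JE]]] := adapted_signed aJ.
have cJ : complex_structure (@gbracket R V lab G)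
    (signed_map s j : {linear nG R G -> nG R G}).
  case: aJ => -[JJ JN] _; split=> [x|x y] /=; first by rewrite -!JE.
  by rewrite -!JE.
have nonpair (e : {e | e \in edges G}) : val e \notin pair_edges j ->
    exists u v w f, [/\ val e = [set u; v], j (inr e) = inr f,
      val f = [set u; w] & j (inl v) = inl w].
  move=> ne; have /eqP/cards2P [u [v [_ Ee]]] := card_edge (valP e).
  apply: (nonpair_edge lab_inj jK sj cJ Ee); apply: contraNneq ne => ju.
  by apply/pair_edgeP; [apply: valP | exists u, v].
(* If [{u, w}] with [w = j v] were a pair matched by [j], then [u = j w = v], although [{u, v}] is
   an edge. *)
have nonpair_image (e f : {e | e \in edges G}) : val e \notin pair_edges j ->
    j (inr e) = inr f -> val f \notin pair_edges j.
  move=> /nonpair [u [v [w [f' [Ee -> Ef jv]]]]] [<-].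
  apply/pair_edgeP; first exact: valP.
  have uv : u != v by apply: (@edge_neq _ G); rewrite -Ee; apply: valP.
  have jw : j (inl w) = inl v by rewrite -jv jK.
  move=> [a [b [jab /eqP]]]; rewrite Ef eq_set2; last first.
    by apply: (@edge_neq _ G); rewrite -Ef; apply: valP.
  case/orP=> /andP [/eqP Ea /eqP Eb]; move: jab; rewrite Ea Eb.
    by move/(canRL jK); rewrite jw => -[E]; rewrite E eqxx in uv.
  by rewrite jw => -[E]; rewrite E eqxx in uv.
pose B := pair_graph j.
have /fin_all_exists [jB jBE] : forall b : gbasis B, exists c : gbasis B,
    pair_basis c = j (pair_basis b).
  (* If [j b] were an edge outside [B], then [b], being its image, would also be an edge outside
     [B]. *)
  move=> b; apply: pair_basis_onto; case jb: (j _) => [//|f].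
  case: b jb => [v|e] jb.
    apply: contraT => /nonpair [u [v' [w [f' [_ jf _ _]]]]].
    by move: jf; rewrite -jb jK.
  apply: contraTT (valP e) => nf.
  exact: nonpair_image nf (etrans (congr1 j (esym jb)) (jK _)).
have jBK : involutive jB by move=> b; apply: pair_basis_inj; rewrite !jBE jK.
pose sB (b : gbasis B) := s (pair_basis b).
have sjB b : sB (jB b) = ~~ sB b by rewrite /sB jBE sj.
have jBn b : jB b != b by apply/eqP=> E; have := sjB b; rewrite E; case: (sB b).
have jBv v w : j (inl v) = inl w -> jB (inl v) = inl w.
  by move=> jv; apply: pair_basis_inj; rewrite jBE.
have paired (e : {e | e \in edges B}) :
    exists v w, val e = [set v; w] /\ jB (inl v) = inl w.
  have /pair_edgeP := valP e; case; first exact: pair_edge_sub (valP e).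
  by move=> v [w [jv Ee]]; exists v, w; split=> //; apply: jBv.
exists B, (signed_map sB jB : {linear nG R B -> nG R B}); split.
- exact: basic_of_pairing jBK jBn paired.
- exact: adapted_signed_map lab_inj jBK sjB paired.
(* The action of [j] on edges, moved to sets of vertices. The default [e] is never met on an edge
   outside [B], whose image is an edge by [nonpair]. *)
pose sw e : {set V} :=
  if insub e is Some e' then
    if j (inr (e' : {e | e \in edges G})) is inr f then val f else e
  else e.
have swE (e f : {e | e \in edges G}) : j (inr e) = inr f -> sw (val e) = val f.
  by rewrite /sw valK => ->.
rewrite /is_expansion.
have -> : edges G = (edges G :\: edges B) :|: edges B.
  rewrite setUC setDE setUIr setUCr setIT; apply/esym/setUidPr/subsetP.
  exact: pair_edge_sub.
apply: (@expansion_of_swaps _ _ _ _ sw).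
  by rewrite -setI_eq0 setIC setIDA setDIl setDv set0I.
move=> x /setDP [xG xB]; pose e : {e | e \in edges G} := Sub x xG.
have [u [v [w [f [Ee je Ef jv]]]]] := nonpair e xB.
have jf : j (inr f) = inr e by rewrite -je jK.
have Es : sw x = val f by rewrite -(swE e).
rewrite Es (swE _ _ jf); split=> //.
- by apply/setDP; split; [apply: valP | apply: (nonpair_image e)].
- apply/eqP=> /(@val_inj _ _ _ f e) E.
  by have := sj (inr e); rewrite je E; case: (s _).
exists u, v, w; split=> //.
- by apply: (@edge_neq _ G); rewrite -Ee; apply: valP.
- by apply: (@edge_neq _ G); rewrite -Ef; apply: valP.
(* [v] and [w] are exchanged up to opposite signs, so exactly one of them is sent to the other with
   sign plus. *)
rewrite /= /vertv !signed_map_basisv // (jBv _ _ jv).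
have jw : j (inl w) = inl v by rewrite -jv jK.
rewrite (jBv _ _ jw) -(jBv _ _ jv) sjB.
by case: (sB _); [right | left]; rewrite scale1r.
Qed.
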